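(* Let $V$ be a real normed space of finite dimension $d\ge1$ whose unit ball is a linear image of a $d$-dimensional cube (i.e. $V$ is linearly isometric to $(\mathbb R^d,\|\cdot\|_\infty)$). Let $U$ be an abelian group with a translation-invariant ultrametric, let $\Lambda\subset V\times U$ be a closed additive subgroup, and let $X=(V\times U)/\Lambda$ carry the quotient metric induced by the maximum product metric. Then for every $\alpha\in X$ and every integer $N\ge2$, $$g_N(\alpha)\le2^d+1.$$ If, in addition, the unit ball of the reduced real factor $\overline V$ is a linear image of a cube, choose corresponding cube coordinates on $\overline V$ (linear coordinates $x_1,\dots,x_{\dim\overline V}$ in which $\|v\|_{\overline V}=\max_i|x_i(v)|$), and let $k$ be the number of cube-coordinate directions occurring in the real projection of $\overline\Lambda$, i.e. the number of indices $i$ such that $x_i(v)\ne0$ for some $(v,u)\in\overline\Lambda$. Then $$g_N(\alpha)\le2^k+1,\qquad k\le\dim\overline V\le d.$$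
   Context: Metric setting. Write the ultrametric on $U$ as $d_U(u,w)=|u-w|_U$, so $|u+w|_U\le\max\{|u|_U,|w|_U\}$. On $V\times U$ put $|(v,u)|=\max\{\|v\|_V,|u|_U\}$; ''closed'' refers to the induced metric topology. On $X=(V\times U)/\Lambda$ put $\|a+\Lambda\|_X=\inf_{\lambda\in\Lambda}|a-\lambda|$ and $d_X(x,y)=\|x-y\|_X$. Nearest-neighbour distances. For $\alpha\in X$ and $N\ge2$ let $\mathcal O_N(\alpha)=\{0,\alpha,\dots,(N-1)\alpha\}$ as a set (repetitions discarded). If it has at least two points put $\delta_N(x)=\min_{y\in\mathcal O_N(\alpha),\,y\ne x}d_X(x,y)$ and $g_N(\alpha)=\#\{\delta_N(x):x\in\mathcal O_N(\alpha)\}$; if it is a singleton, $g_N(\alpha)=0$. Reduced real factor. $W=\{v\in V:(tv,0)\in\Lambda\text{ for every }t\in\mathbb R\}$, a linear subspace of $V$; $\overline V=V/W$ with the quotient norm; $\overline\Lambda$ is the image of $\Lambda$ in $\overline V\times U$. *)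

(* Defs.v *)
From HB Require Import structures.
From mathcomp Require Import all_boot all_order all_algebra.
From mathcomp Require Import finmap.
From mathcomp Require Import all_classical all_reals all_analysis.

Set Implicit Arguments.
Unset Strict Implicit.
Unset Printing Implicit Defensive.

Import Order.TTheory GRing.Theory Num.Theory.
Import numFieldNormedType.Exports.

Local Open Scope classical_set_scope.
Local Open Scope ring_scope.
Local Open Scope quotient_scope.

(* The library's normed Z-modules require |x *+ n| = |x| *+ n, which fails for
   ultrametric norms, so the metric on U is carried separately. *)
Record invariant_ultrametric (R : realType) (U : zmodType) := InvUltrametric {
  udist :> U -> U -> R;
  udistxx : forall u, udist u u = 0;
  udist_positivity : forall u w, udist u w = 0 -> u = w;
  udist_sym : forall u w, udist u w = udist w u;
  udist_ultra : forall v u w, udist u w <= Num.max (udist u v) (udist v w);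
  udist_invariant : forall v u w, udist (u + v) (w + v) = udist u w
}.

(* U with the topology of its ultrametric *)
Definition ultra (R : realType) (U : zmodType)
  (D : invariant_ultrametric R U) : Type := U.

Section UltrametricSpace.
Context (R : realType) (U : zmodType) (D : invariant_ultrametric R U).

Lemma udist_ge0 u w : 0 <= D u w.
Proof.
by have := udist_ultra D w u u; rewrite udistxx [D w u]udist_sym maxxx.
Qed.

Lemma udist_triangle v u w : D u w <= D u v + D v w.
Proof.
apply: le_trans (udist_ultra D v u w) _.
by rewrite ge_max lerDl lerDr !udist_ge0.
Qed.

HB.instance Definition _ := GRing.Zmodule.copy (ultra D) U.
HB.instance Definition _ := @isMetric.Build R (ultra D) D
  (udistxx D) (@udist_positivity _ _ D) (udist_sym D) udist_triangle.

End UltrametricSpace.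

Section LmodQuotient.
Context (K : pzRingType) (V : lmodType K) (S : zmodClosed V).
Context (SZ : GRing.scaler_closed S).

(* The library only provides the additive group structure on a quotient by a
   subgroup; scaling is added here for a subgroup closed under scaling. *)
Definition lquot & GRing.scaler_closed S : Type := Quotient.quot S.
Local Notation Q := (lquot SZ).

HB.instance Definition _ := GRing.Zmodule.on Q.
HB.instance Definition _ :=
  EqQuotient.copy Q (Quotient.quot S).

Definition lquot_scale (a : K) (x : Q) : Q := \pi_Q (a *: repr x).

Lemma lquot_scale_pi a v : lquot_scale a (\pi_Q v) = \pi_Q (a *: v).
Proof.
apply/eqP; rewrite /lquot_scale -[_ == _]Quotient.idealrBE -scalerBr SZ//.
by rewrite Quotient.idealrBE reprK.
Qed.

Lemma lquot_piD u v : \pi_Q (u + v) = \pi_Q u + \pi_Q v :> Q.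
Proof. exact: Quotient.pi_add. Qed.

Lemma lquot_scaleA a b x :
  lquot_scale a (lquot_scale b x) = lquot_scale (a * b) x.
Proof.
elim/quotW: x => v; rewrite (lquot_scale_pi b v) (lquot_scale_pi a (b *: v)).
by rewrite (lquot_scale_pi (a * b) v) scalerA.
Qed.

Lemma lquot_scale1 : left_id 1 lquot_scale.
Proof. by elim/quotW => v; rewrite (lquot_scale_pi 1 v) scale1r. Qed.

Lemma lquot_scaleDr : right_distributive lquot_scale +%R.
Proof.
move=> a; elim/quotW => u; elim/quotW => v.
rewrite -(lquot_piD u v) (lquot_scale_pi a (u + v)) scalerDr.
by rewrite (lquot_piD (a *: u)) (lquot_scale_pi a u) (lquot_scale_pi a v).
Qed.

Lemma lquot_scaleDl x : {morph lquot_scale^~ x : a b / a + b}.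
Proof.
elim/quotW: x => v a b; rewrite (lquot_scale_pi (a + b) v) scalerDl.
by rewrite (lquot_piD (a *: v)) (lquot_scale_pi a v) (lquot_scale_pi b v).
Qed.

HB.instance Definition _ := GRing.Zmodule_isLmodule.Build K Q
  lquot_scaleA lquot_scale1 lquot_scaleDr lquot_scaleDl.

End LmodQuotient.

Definition quot_norm (R : realType) (G : zmodType) (H : zmodClosed G)
    (nrm : G -> R) (x : Quotient.quot H) : R :=
  inf [set nrm (repr x - h) | h in [set h | h \in H]].

Lemma quot_normE (R : realType) (G : zmodType) (H : zmodClosed G)
    (nrm : G -> R) (a : G) :
  quot_norm nrm (\pi_(Quotient.quot H) a)
  = inf [set nrm (a - h) | h in [set h | h \in H]].
Proof.
set b := repr (\pi_(Quotient.quot H) a).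
have ab : a - b \in H by rewrite Quotient.idealrBE reprK.
rewrite /quot_norm -/b; congr inf; apply/seteqP; split => _ [h /= Hh <-].
- exists (h + (a - b)) => /=; first exact: rpredD.
  by congr nrm; rewrite opprD addrCA subKr addrC.
- exists (h - (a - b)) => /=; first exact: rpredB.
  by congr nrm; rewrite opprB addrA [b + _]addrC addrNK.
Qed.

(* The norm on 'rV_n is the maximum of the absolute values of the entries;
   bijectivity makes n the dimension of E, and n = 0 is allowed. *)
Definition cube_coordinates (R : realType) (E : lmodType R) (nrm : E -> R)
    (n : nat) (x : {linear E -> 'rV[R]_n}) : Prop :=
  bijective x /\ forall v, nrm v = `|x v|.

Section QuotientGroup.
Context (R : realType) (V : normedModType R).
Context (U : zmodType) (D : invariant_ultrametric R U).
Context (Lambda : zmodClosed (V * ultra D)%type).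

Definition pair_norm (p : V * ultra D) : R := Num.max `|p.1| (D p.2 0).

(* The product topology on V * ultra D is the one of the maximum metric. *)
Lemma ball_pair_norm (p q : V * ultra D) (e : R) :
  ball p e q <-> pair_norm (p - q) < e.
Proof.
rewrite /pair_norm gt_max.
have -> : D (p - q).2 0 = D p.2 q.2.
  by rewrite -(udist_invariant D q.2 (p - q).2 0) add0r;
    congr (D _ _); exact: addrNK.
split; first by move=> [/=]; rewrite -ball_normE ballEmdist => -> ->.
by move=> /andP[pq1 pq2]; split; rewrite /= -?ball_normE ?ballEmdist.
Qed.

Definition quotX : zmodType := Quotient.quot Lambda.

Definition normX : quotX -> R := quot_norm pair_norm.

Definition distX (x y : quotX) : R := normX (x - y).

Definition orbitX (alpha : quotX) (N : nat) : {fset quotX} :=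
  [fset alpha *+ val n | n in 'I_N]%fset.

(* The infimum is a minimum, see deltaP. *)
Definition delta (alpha : quotX) (N : nat) (x : quotX) : R :=
  inf [set distX x y | y in [set y | y \in orbitX alpha N /\ y <> x]].

Definition gapnum (alpha : quotX) (N : nat) : nat :=
  if (2 <= #|` orbitX alpha N|)%N
  then #|` [fset delta alpha N x | x in orbitX alpha N]%fset| else 0%N.

Lemma deltaP (alpha : quotX) (N : nat) (x : quotX) :
  (2 <= #|` orbitX alpha N|)%N ->
  (exists y, [/\ y \in orbitX alpha N, y <> x
               & delta alpha N x = distX x y]) /\
  (forall y, y \in orbitX alpha N -> y <> x -> delta alpha N x <= distX x y).
Proof.
set O := orbitX alpha N => O2.
have [y0 y0O /eqP y0x] : exists2 y, y \in O & y != x.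
  have : (0 < #|` O `\ x|%fset)%N.
    move: O2; rewrite (cardfsD1 x); case: (x \in O) => //=.
    by rewrite add0n => /ltnW.
  by rewrite cardfs_gt0 => /fset0Pn[y]; rewrite in_fsetD1 => /andP[? ?]; exists y.
have /= := @Order.TotalTheory.arg_minP _ _ O [` y0O]%fset
  (fun y => val y != x) (fun y => distX x (val y)).
case; first exact/eqP.
move=> y /eqP yx ymin.
have dE : delta alpha N x = distX x (val y).
  apply/eqP; rewrite eq_le; apply/andP; split.
    apply: ge_inf; last by exists (val y) => //; split => //; exact: valP.
    exists (distX x (val y)) => _ [z /= [zO /eqP zx] <-].
    exact: (ymin [` zO]%fset).
  apply: lb_le_inf; first by exists (distX x y0), y0.
  by move=> _ [z /= [zO /eqP zx] <-]; exact: (ymin [` zO]%fset).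
split; first by exists (val y); split => //; exact: valP.
by move=> z zO /eqP zx; rewrite dE; exact: (ymin [` zO]%fset).
Qed.

Definition W : {pred V} := fun v => `[< forall t : R, (t *: v, 0) \in Lambda >].

Lemma W_zmod_closed : zmod_closed W.
Proof.
split=> [|u v /asboolP Wu /asboolP Wv]; apply/asboolP => t.
  by rewrite scaler0; exact: (rpred0 Lambda).
rewrite scalerBr.
by have := rpredB (Wu t) (Wv t); rewrite -[X in X \in _]/(_, 0 - 0) subr0.
Qed.

HB.instance Definition _ := GRing.isZmodClosed.Build V W W_zmod_closed.

Lemma W_scaler_closed : GRing.scaler_closed W.
Proof.
by move=> a v /asboolP Wv; apply/asboolP => t; rewrite scalerA; exact: Wv.
Qed.

Definition Vbar : lmodType R := lquot W_scaler_closed.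

Definition normVbar (x : Vbar) : R := quot_norm (fun v : V => `|v|) x.

Definition Lambdabar : set (Vbar * ultra D) :=
  [set (\pi_(lquot W_scaler_closed) p.1, p.2) | p in [set p | p \in Lambda]].

Definition num_directions (m : nat) (x : {linear Vbar -> 'rV[R]_m}) : nat :=
  #|[pred i : 'I_m | `[< exists2 p, Lambdabar p & x p.1 ord0 i != 0 >]]|.

End QuotientGroup.

(* Main.v *)
(* For a point n alpha of the orbit, delta is the least nonzero norm of k alpha
   with 0 < k <= M', where M' = max(n, N - 1 - n) lies between
   M = ceil((N - 1) / 2) and N - 1 <= 2 M. Let rho be the value for M' = M. Each
   smaller value is the norm of some k alpha with M < k <= 2 M, and two such k
   differ by less than M, so the norm of their difference times alpha is 0 or at
   least rho. Lift each k alpha to V * U with norm less than rho: by the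
   ultrametric inequality the U-components of two lifts stay within rho, so if
   the values differ then some cube coordinate must separate the lifts by rho,
   which forces opposite signs there. In a direction that does not occur in
   Lambda the lifts are k times a fixed real number and cannot be separated.
   Hence distinct values below rho give distinct sets of nonnegative occurring
   coordinates. Replacing V by Vbar does not change the norm of X, because W x 0
   is contained in Lambda. *)
From HB Require Import structures.
Require Import Defs.
From mathcomp Require Import all_boot all_order all_algebra.
From mathcomp Require Import finmap.
From mathcomp Require Import zify lra.
From mathcomp Require Import all_classical all_reals all_analysis.

Set Implicit Arguments.
Unset Strict Implicit.
Unset Printing Implicit Defensive.

Import Order.TTheory GRing.Theory Num.Theory.
Import numFieldNormedType.Exports.

Local Open Scope classical_set_scope.
Local Open Scope ring_scope.
Local Open Scope quotient_scope.

(** For [m = 0] there is no entry to test and the norm is 0, hence the separate condition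
    [0 < r]. *)
Lemma row_norm_ltP (R : realType) (m : nat) (a : 'rV[R]_m) (r : R) :
  `|a| < r <-> 0 < r /\ forall i, `|a ord0 i| < r.
Proof.
rewrite [ `|a|]mx_normrE; split=> [/bigmax_ltP[r0 ar]|[r0 ar]].
  by split=> // i; exact: (ar (ord0, i)).
by apply/bigmax_ltP; split=> // -[i j] _ /=; rewrite ord1.
Qed.

(** Preimages under [g] of the unit vectors are linearly independent, and the injective [f] turns
    them into [m] independent rows of length [n]. *)
Lemma leq_dim_surj (F : fieldType) (V : lmodType F) (m n : nat)
    (f : {linear V -> 'rV[F]_n}) (g : {linear V -> 'rV[F]_m}) :
  injective f -> (forall w, exists v, g v = w) -> (m <= n)%N.
Proof.
move=> finj gsurj.
pose v i := sval (cid (gsurj (delta_mx 0 i))).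
have gv i : g (v i) = delta_mx 0 i by rewrite /v; case: cid.
pose B := \matrix_(i < m) f (v i).
suff /eqP <- : row_free B by exact: rank_leq_col.
rewrite -kermx_eq0; apply/rowV0P => c /sub_kermxP cB.
have : f (\sum_i c 0 i *: v i) = 0.
  rewrite linear_sum -[RHS]cB mulmx_sum_row.
  by apply: eq_bigr => i _; rewrite linearZ rowK.
rewrite -(linear0 f) => /finj /(congr1 g); rewrite linear0 linear_sum => <-.
rewrite {1}[c]row_sum_delta.
by apply: eq_bigr => i _; rewrite linearZ gv.
Qed.

(** * Strict bounds on quotient norms *)

Section QuotientNorm.
Context (R : realType) (G : zmodType) (H : zmodClosed G) (nrm : G -> R).
Hypothesis nrm_ge0 : forall g, 0 <= nrm g.

(** The strict inequality yields a witness [h] even when the infimum is not attained. *)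
Lemma quot_norm_ltP (a : G) (r : R) :
  quot_norm nrm (\pi_(Quotient.quot H) a) < r <->
  exists2 h, h \in H & nrm (a - h) < r.
Proof.
rewrite quot_normE; split=> [|[h hH]].
  case/inf_lt => [|_ [h hH <-] ahr]; last by exists h.
  by exists (nrm (a - 0)), 0 => //=; exact: rpred0.
apply: le_lt_trans; apply: ge_inf; last by exists h.
by exists 0 => _ [h' _ <-].
Qed.

Lemma quot_normN (x : Quotient.quot H) :
  (forall g, nrm (- g) = nrm g) -> quot_norm nrm (- x) = quot_norm nrm x.
Proof.
move=> nrmN; elim/quotW: x => a.
have -> : - \pi_(Quotient.quot H) a = \pi_(Quotient.quot H) (- a).
  by rewrite raddfN.
rewrite !quot_normE; congr inf; apply/seteqP; split => _ [h /= hH <-];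
  exists (- h); rewrite ?rpredN // -[LHS]nrmN opprD ?opprK//.
Qed.

End QuotientNorm.

(** * From nearest neighbours to norms of multiples *)

Section Gaps.
Context (R : realType) (V : normedModType R).
Context (U : zmodType) (D : invariant_ultrametric R U).
Context (Lambda : zmodClosed (V * ultra D)%type).
Local Notation X := (quotX Lambda).

Lemma udistN0 (u : U) : D (- u) 0 = D u 0.
Proof. by rewrite -(udist_invariant D u) addNr add0r udist_sym. Qed.

Lemma udistB0 (u w : U) : D (u - w) 0 = D u w.
Proof. by rewrite -(udist_invariant D w) subrK add0r. Qed.

Lemma pair_norm_ge0 (p : V * ultra D) : 0 <= pair_norm p.
Proof. by rewrite /pair_norm le_max normr_ge0. Qed.

Lemma fstMn (p : V * ultra D) (k : nat) : (p *+ k).1 = p.1 *+ k.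
Proof. exact: raddfMn. Qed.

Lemma sndMn (p : V * ultra D) (k : nat) : (p *+ k).2 = p.2 *+ k.
Proof. exact: raddfMn. Qed.

Lemma distXC (x y : X) : distX x y = distX y x.
Proof.
rewrite /distX -opprB; apply: quot_normN => p.
by rewrite /pair_norm /= normrN udistN0.
Qed.

Lemma orbitXP (alpha : X) (N : nat) (x : X) :
  reflect (exists2 n, (n < N)%N & x = alpha *+ n) (x \in orbitX alpha N).
Proof.
apply: (iffP (imfsetP _ _ _ _)) => [[n _ ->]|[n nN ->]].
  by exists (\val n); rewrite ?ltn_ord.
by exists (Ordinal nN).
Qed.

(* Translating by -n alpha, the points of the orbit become the multiples
   k alpha with -n <= k <= N - 1 - n, so up to sign those with
   k <= max(n, N - 1 - n). *)
Lemma delta_multiples (alpha : X) (N n : nat) :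
  (2 <= #|` orbitX alpha N|)%N -> (n < N)%N ->
  (exists k, [/\ (0 < k <= maxn n (N.-1 - n))%N, alpha *+ k != 0
     & delta alpha N (alpha *+ n) = normX (alpha *+ k)]) /\
  (forall k, (0 < k <= maxn n (N.-1 - n))%N -> alpha *+ k != 0 ->
     delta alpha N (alpha *+ n) <= normX (alpha *+ k)).
Proof.
move=> O2 nN.
have [[y [/orbitXP[j jN ->] jn dE]] dmin] := deltaP (alpha *+ n) O2.
split.
  case: (leqP j n) => [le_jn|lt_nj].
    have E : alpha *+ n - alpha *+ j = alpha *+ (n - j) by rewrite mulrnBr.
    exists (n - j)%N; split; last by rewrite dE /distX E.
      have : j != n by apply: contra_notN jn => /eqP ->.
      lia.
    by rewrite -E subr_eq0; apply/eqP => /esym.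
  have E : alpha *+ j - alpha *+ n = alpha *+ (j - n).
    by rewrite mulrnBr // ltnW.
  exists (j - n)%N; split; last by rewrite dE distXC /distX E.
    lia.
  by rewrite -E subr_eq0; apply/eqP.
move=> k kM k0.
have [le_kn|lt_nk] := leqP k n.
  have E : alpha *+ n - alpha *+ (n - k) = alpha *+ k.
    by rewrite -mulrnBr ?leq_subr// subKn.
  rewrite -E; apply: dmin; first by apply/orbitXP; exists (n - k)%N => //; lia.
  by move=> /esym/eqP; rewrite -subr_eq0 E (negPf k0).
have E : alpha *+ (n + k) - alpha *+ n = alpha *+ k.
  by rewrite mulrnDr addrC addKr.
rewrite -E; apply: (le_trans (dmin (alpha *+ (n + k)) _ _)).
- by apply/orbitXP; exists (n + k)%N => //; lia.
- by move/eqP; rewrite -subr_eq0 E (negPf k0).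
- by rewrite distXC.
Qed.

(** * Counting the values by sign patterns *)

Section Coordinates.
Context (m : nat) (y : {additive V -> 'rV[R]_m}).
(** Left as a hypothesis so that the bound serves both coordinates on [V] and coordinates on [Vbar]
    composed with the projection. *)
Hypothesis normX_ltP : forall (p : V * ultra D) (r : R),
  normX (\pi_X p) < r <->
  exists2 l, l \in Lambda & `|y (p.1 - l.1)| < r /\ D (p.2 - l.2) 0 < r.

Definition occurring : {set 'I_m} :=
  [set i | `[< exists2 l, l \in Lambda & y l.1 ord0 i != 0 >]].

Definition signs (v : V) : {set 'I_m} :=
  [set i in occurring | 0 <= y v ord0 i].

(* In an occurring direction equal signs keep the difference below r; in any
   other direction the lifts are exactly k t and j t, and k - j <= k. *)
Lemma close_lifts (p l l' : V * ultra D) (j k : nat) (r : R) :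
  (j <= k)%N -> l \in Lambda -> l' \in Lambda ->
  `|y (p.1 *+ j - l.1)| < r -> D (p.2 *+ j - l.2) 0 < r ->
  `|y (p.1 *+ k - l'.1)| < r -> D (p.2 *+ k - l'.2) 0 < r ->
  signs (p.1 *+ j - l.1) = signs (p.1 *+ k - l'.1) ->
  normX (\pi_X p *+ (k - j)) < r.
Proof.
move=> jk lL l'L yj Dj yk Dk sgn.
have -> : \pi_X p *+ (k - j) = \pi_X (p *+ (k - j)) by rewrite raddfMn.
apply/normX_ltP; exists (l' - l); first exact: rpredB.
have E1 : (p *+ (k - j)).1 - (l' - l).1 =
          (p.1 *+ k - l'.1) - (p.1 *+ j - l.1).
  by rewrite mulrnBr //= !fstMn !opprB addrACA [RHS]addrACA [- _ - _]addrC.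
have E2 : (p *+ (k - j)).2 - (l' - l).2 =
          (p.2 *+ k - l'.2) - (p.2 *+ j - l.2).
  by rewrite mulrnBr //= !sndMn !opprB addrACA [RHS]addrACA [- _ - _]addrC.
rewrite E1 E2; split; last first.
  rewrite udistB0; apply: le_lt_trans (udist_ultra D 0 _ _) _.
  by rewrite gt_max Dk udist_sym.
move: yj yk => /row_norm_ltP[r0 yj] /row_norm_ltP[_ yk].
apply/row_norm_ltP; split => // i.
rewrite [y (_ - (_ - _))]raddfB /= [(y _ - y _) _ _]mxE [(- y _) _ _]mxE.
move: (yj i) (yk i) (congr1 (fun A : {set _} => i \in A) sgn).
rewrite !inE; case: asboolP => [_ /= |nocc _].
  move: (y _ _ _) (y _ _ _) => b a.
  rewrite !ltr_norml => /andP[a1 a2] /andP[b1 b2].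
  case: (lerP 0 a) => ha; case: (lerP 0 b) => hb // _.
    by apply/andP; split; lra.
  by apply/andP; split; lra.
have y0 q : q \in Lambda -> y q.1 ord0 i = 0.
  by move=> qL; apply/eqP; apply: contra_notT nocc => qi; exists q.
rewrite !raddfB /= !raddfMn /= ![(_ - y _) _ _]mxE ![(- y _) _ _]mxE.
rewrite !mulmxnE (y0 _ lL) (y0 _ l'L) !subr0 => yki _.
rewrite -mulrnBr // normrMn; apply: le_lt_trans yki.
by rewrite normrMn ler_wpMn2l ?leq_subr.
Qed.

Lemma gapnum_le (alpha : X) (N : nat) :
  (gapnum alpha N <= 2 ^ #|occurring| + 1)%N.
Proof.
rewrite /gapnum; case: ifP => // O2.
have N0 : (0 < N)%N.
  have : orbitX alpha N != fset0 by rewrite -cardfs_gt0 ltnW.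
  by case/fset0Pn=> _ /orbitXP[j jN _]; apply: leq_ltn_trans jN.
set S := [fset _ | _ in _]%fset.
(* The index [n] is the middle of the orbit: there max(n, N - 1 - n) takes its least value [M], so
   [rho] is the largest value of [delta]. *)
pose n := (N.-1)./2; pose M := (N.-1 - n)%N.
have nN : (n < N)%N by rewrite /n; lia.
pose rho := delta alpha N (alpha *+ n).
have rho_min k : (0 < k <= M)%N -> alpha *+ k != 0 -> rho <= normX (alpha *+ k).
  move=> kM; apply: (delta_multiples O2 nN).2; rewrite /M in kM; lia.
pose a := repr alpha.
pose T s (A : {set 'I_m}) := exists k l, [/\ (M < k <= M.*2)%N /\ l \in Lambda,
  s = normX (alpha *+ k), `|y (a.1 *+ k - l.1)| < rho,
  D (a.2 *+ k - l.2) 0 < rho & A = signs (a.1 *+ k - l.1)].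
have T_inj s s' A : T s A -> T s' A -> s = s'.
  move=> [k [l [[kM lL] -> yk Dk Ak]]] [k' [l' [[k'M l'L] -> yk' Dk' Ak']]].
  wlog kk' : k k' l l' kM k'M lL l'L yk Dk Ak yk' Dk' Ak' / (k <= k')%N => [W|].
    case: (leqP k k') => [|/ltnW] kk'; first exact: (W k k' l l').
    by symmetry; exact: (W k' k l' l).
  (* If the two multiples coincide, so do their norms. Otherwise 0 < k' - k <= M, and the close
     lifts contradict the minimality of [rho]. *)
  have [/eqP|nz] := eqVneq (alpha *+ (k' - k)) 0.
    by rewrite mulrnBr // subr_eq0 => /eqP ->.
  have k'k : (0 < k' - k <= M)%N.
    by case: (posnP (k' - k)) nz => [->|]; rewrite ?mulr0n ?eqxx // => *; lia.
  have := rho_min _ k'k nz; rewrite leNgt => /negP[].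
  rewrite -[alpha]reprK.
  by apply: (close_lifts kk' lL l'L) => //; rewrite -Ak.
have T_ex s : s \in (S `\ rho)%fset -> exists A, T s A /\ A \subset occurring.
  rewrite in_fsetD1 => /andP[s_rho /imfsetP[x /= /orbitXP[j jN ->] sE]].
  have [[k [kM k0 dE]] dmin] := delta_multiples O2 jN.
  (* The range of multiples for [j] contains the one for [n], where [rho] is attained. *)
  have s_lt : s < rho.
    rewrite lt_neqAle s_rho /=.
    have [[k1 [k1M k10 rE]] _] := delta_multiples O2 nN.
    rewrite sE /rho rE; apply: dmin => //; rewrite /n in k1M *; lia.
  have Mk : (M < k)%N.
    rewrite ltnNge; apply/negP => kM'.
    move: s_lt; rewrite ltNge sE dE rho_min //; lia.
  have [l lL [yl Dl]] : exists2 l, l \in Lambda &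
      `|y ((a *+ k).1 - l.1)| < rho /\ D ((a *+ k).2 - l.2) 0 < rho.
    by apply/normX_ltP; rewrite raddfMn /= reprK -dE -sE.
  exists (signs (a.1 *+ k - l.1)); split; last first.
    by apply/fintype.subsetP => i; rewrite inE => /andP[].
  exists k, l; split => //.
  - split => //; move: kM; rewrite Mk /M /n; lia.
  - by rewrite sE dE.
  - by move: yl; rewrite fstMn.
  - by move: Dl; rewrite sndMn.
(* The value [rho] accounts for the summand 1; the other values inject into the subsets of
   [occurring]. *)
rewrite (cardfsD1 rho) addnC leq_add ?leq_b1 // -card_powerset cardfE.
pose g (s : (S `\ rho)%fset) := sval (cid (T_ex (val s) (valP s))).
have gP s : T (val s) (g s) /\ g s \subset occurring by rewrite /g; case: cid.
have g_inj : injective g.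
  move=> s s' ss'; apply: val_inj; apply: (T_inj _ _ (g s)).
    exact: (gP s).1.
  by rewrite ss'; exact: (gP s').1.
rewrite -(card_imset _ g_inj).
apply/subset_leq_card/fintype.subsetP => _ /imsetP[s _ ->].
by rewrite powersetE; exact: (gP s).2.
Qed.

End Coordinates.

(** * The norm of X through [V] and through [Vbar] *)

Lemma normX_pairP (p : V * ultra D) (r : R) :
  normX (\pi_X p) < r <->
  exists2 l, l \in Lambda & `|p.1 - l.1| < r /\ D (p.2 - l.2) 0 < r.
Proof.
apply: (iff_trans (quot_norm_ltP Lambda pair_norm_ge0 p r)).
by split=> -[l lL lr]; exists l => //; move: lr; rewrite gt_max => /andP.
Qed.

Definition piVbar (v : V) : Vbar Lambda :=
  \pi_(lquot (W_scaler_closed (Lambda := Lambda))) v.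

Lemma piVbar_is_linear : linear piVbar.
Proof.
move=> a u v; rewrite /piVbar lquot_piD; congr (_ + _).
by rewrite -lquot_scale_pi.
Qed.

HB.instance Definition _ :=
  GRing.isLinear.Build R V (Vbar Lambda) *:%R piVbar piVbar_is_linear.

Lemma normVbar_ltP (v : V) (r : R) :
  normVbar (piVbar v) < r <->
  exists2 w, (forall t : R, (t *: w, 0) \in Lambda) & `|v - w| < r.
Proof.
apply: (iff_trans (quot_norm_ltP _ (@normr_ge0 R V) v r)).
by split=> -[w /asboolP wW vw]; exists w.
Qed.

Lemma normX_VbarP (p : V * ultra D) (r : R) :
  normX (\pi_X p) < r <->
  exists2 l, l \in Lambda &
    normVbar (piVbar (p.1 - l.1)) < r /\ D (p.2 - l.2) 0 < r.
Proof.
apply: (iff_trans (normX_pairP p r)); split=> -[l lL [pl1 pl2]].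
  exists l => //; split => //; apply/normVbar_ltP.
  by exists 0 => [t|]; rewrite ?subr0 // scaler0; exact: rpred0.
(* Taking t = 1 puts (w, 0) in [Lambda], so the correction [w] can be absorbed into [l]. *)
have /normVbar_ltP[w /(_ 1) wL pw] := pl1.
exists (l + (w, 0)); first by rewrite rpredD // -[w]scale1r.
by split; rewrite /= ?addr0 // opprD addrA.
Qed.

End Gaps.

Theorem corollary2 (R : realType) (d : nat) (V : normedModType R)
    (U : zmodType) (D : invariant_ultrametric R U)
    (Lambda : zmodClosed (V * ultra D)%type) :
  (1 <= d)%N ->
  (exists x : {linear V -> 'rV[R]_d},
     cube_coordinates (fun v : V => `|v|) x) ->
  closed [set p : V * ultra D | p \in Lambda] ->
  (forall (alpha : quotX Lambda) (N : nat), (2 <= N)%N ->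
     (gapnum alpha N <= 2 ^ d + 1)%N)
  /\
  (forall (m : nat) (x : {linear Vbar Lambda -> 'rV[R]_m}),
     cube_coordinates (@normVbar R V U D Lambda) x ->
     (forall (alpha : quotX Lambda) (N : nat), (2 <= N)%N ->
        (gapnum alpha N <= 2 ^ num_directions x + 1)%N)
     /\ (num_directions x <= m <= d)%N).
Proof.
move=> _ [c [c_bij cE]] _; split=> [alpha N _|m x [x_bij xE]].
  apply: leq_trans (gapnum_le (y := c) _ alpha N) _.
    move=> p r; apply: (iff_trans (normX_pairP Lambda p r)).
    by split=> -[l lL lr]; exists l => //; move: lr; rewrite cE.
  by rewrite leq_add2r leq_exp2l // -[leqRHS]card_ord max_card.
(* Since [Lambdabar] is the image of [Lambda], its directions can be read off on [V] through the
   projection. *)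
have occ : num_directions x = #|occurring Lambda (x \o piVbar Lambda)|.
  rewrite /num_directions cardsE; apply: eq_card => i; rewrite !inE.
  apply: asbool_equiv_eq; split.
    by case=> _ [l lL <-] xl; exists l.
  by case=> l lL xl; exists (piVbar Lambda l.1, l.2) => //; exists l.
split=> [alpha N _|].
  rewrite occ; apply: gapnum_le => p r.
  apply: (iff_trans (normX_VbarP Lambda p r)).
  by split=> -[l lL lr]; exists l => //; move: lr; rewrite xE.
rewrite -{2}(card_ord m) max_card /=.
apply: (@leq_dim_surj _ V _ _ c (x \o piVbar Lambda)); first exact: bij_inj.
move=> w; case: x_bij => x' _ xK; exists (repr (x' w)).
by rewrite /= /piVbar reprK xK.
Qed.
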